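(* Let $L$ be a weakly dicomplemented lattice, $X$ a nonempty set and $x\in X$ a fixed element. For $S\subseteq L$ put $L^{X}(x,S)=\{f\in L^{X}\mid f(x)\in S\}$, and for $Y\subseteq L^{2}$ put $L^{X}(x,Y)=\{(f,g)\in (L^{X})^{2}\mid (f(x),g(x))\in Y\}$. Let $\gamma:F(L)\to F(L^{X})$, $\gamma(F)=L^{X}(x,F)$, and $\mu:\mathrm{Con}(L)\to\mathrm{Con}(L^{X})$, $\mu(\theta)=L^{X}(x,\theta)$. Then: (1) $\gamma$ is an embedding of lattices. In particular, if $F\in F(L)$ is normal, then $\gamma(F)$ is normal. (2) $\mathrm{Con}(L)$ embeds into $\mathrm{Con}(L^{X})$ via $\mu$. In particular, if $L$ is distributive, $F\in NF(L)$ and $\theta=\Theta(F)$, then $\mu(\theta)=\theta_{L^{X}(x,F)}$. (3) $\{L^{X}(x,F)\mid F\in NF(L)\}\subseteq NF(L^{X})$.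
   Context: A weakly dicomplemented lattice (WDL) is an algebra $(L;\wedge,\vee,{}^{\Delta},{}^{\nabla},0,1)$ of type $(2,2,1,1,0,0)$ such that $(L;\wedge,\vee,0,1)$ is a bounded lattice and for all $x,y\in L$: $x^{\Delta\Delta}\le x$; $x\le y\Rightarrow y^{\Delta}\le x^{\Delta}$; $(x\wedge y)\vee(x\wedge y^{\Delta})=x$; $x^{\nabla\nabla}\ge x$; $x\le y\Rightarrow y^{\nabla}\le x^{\nabla}$; $(x\vee y)\wedge(x\vee y^{\nabla})=x$. $L^{X}$ is the WDL of all maps $X\to L$ with pointwise operations. For a WDL $K$: a filter is a nonempty upward closed subset closed under $\wedge$ ($K$ itself is allowed); $F(K)$ is the lattice of filters ordered by inclusion; a filter $F$ is normal if $a\in F$ implies $(a^{\Delta})^{\nabla}\in F$; $NF(K)$ is the set of normal filters; $\mathrm{Con}(K)$ is the lattice of congruences (equivalence relations compatible with $\wedge,\vee,{}^{\Delta},{}^{\nabla}$), ordered by inclusion. $\Theta(F)$ is the smallest congruence $\theta$ of $K$ with $(a,1)\in\theta$ for all $a\in F$. For a normal filter $H$ of $K$, $\theta_{H}=\{(a,b)\in K^{2}\mid \exists u\in H,\ a\vee u^{\Delta}=b\vee u^{\Delta}\}$. *)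

(* Defs.v *)
From HB Require Import structures.
From mathcomp Require Import all_boot all_order.
From mathcomp Require Import boolp classical_sets.

Set Implicit Arguments.
Unset Strict Implicit.
Unset Printing Implicit Defensive.

Import Order.TTheory.
Local Open Scope classical_set_scope.
Local Open Scope order_scope.

(* [wcompl] is the weak complementation, written with a superscript Delta on   *)
(* paper; [dwcompl] is the dual weak complementation (superscript nabla).      *)
HB.mixin Record isWDL (d : Order.disp_t) L of Order.TBLattice d L := {
  wcompl : L -> L;
  dwcompl : L -> L;
  wcomplK_le : forall x, wcompl (wcompl x) <= x;
  wcompl_anti : forall x y, x <= y -> wcompl y <= wcompl x;
  wcompl_joinI : forall x y, (x `&` y) `|` (x `&` wcompl y) = x;
  dwcomplK_ge : forall x, x <= dwcompl (dwcompl x);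
  dwcompl_anti : forall x y, x <= y -> dwcompl y <= dwcompl x;
  dwcompl_meetU : forall x y, (x `|` y) `&` (x `|` dwcompl y) = x
}.

#[short(type="wdlType")]
HB.structure Definition WDL (d : Order.disp_t) :=
  { L of isWDL d L & Order.TBLattice d L }.

(* The lattice structure on [X -> L] is the pointwise one of [boolp]. *)
Section FunTBLattice.
Variables (X : Type) (d : Order.disp_t) (L : tbLatticeType d).

Fact fun_le0x (f : X -> L) : (fun=> \bot) <= f.
Proof. by apply/lefP => y; exact: le0x. Qed.

Fact fun_lex1 (f : X -> L) : f <= (fun=> \top).
Proof. by apply/lefP => y; exact: lex1. Qed.

HB.instance Definition _ := Order.hasBottom.Build _ (X -> L) fun_le0x.
HB.instance Definition _ := Order.hasTop.Build _ (X -> L) fun_lex1.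
End FunTBLattice.

Section FunWDL.
Variables (X : Type) (d : Order.disp_t) (L : wdlType d).
Implicit Types f g : X -> L.

Definition wcomplf f : X -> L := fun y => wcompl (f y).
Definition dwcomplf f : X -> L := fun y => dwcompl (f y).

Fact wcomplfK_le f : wcomplf (wcomplf f) <= f.
Proof. by apply/lefP => y; exact: wcomplK_le. Qed.

Fact wcomplf_anti f g : f <= g -> wcomplf g <= wcomplf f.
Proof. by move=> /lefP fg; apply/lefP => y; exact: wcompl_anti. Qed.

Fact wcomplf_joinI f g : (f `&` g) `|` (f `&` wcomplf g) = f.
Proof. by apply/funext => y; exact: wcompl_joinI. Qed.

Fact dwcomplfK_ge f : f <= dwcomplf (dwcomplf f).
Proof. by apply/lefP => y; exact: dwcomplK_ge. Qed.

Fact dwcomplf_anti f g : f <= g -> dwcomplf g <= dwcomplf f.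
Proof. by move=> /lefP fg; apply/lefP => y; exact: dwcompl_anti. Qed.

Fact dwcomplf_meetU f g : (f `|` g) `&` (f `|` dwcomplf g) = f.
Proof. by apply/funext => y; exact: dwcompl_meetU. Qed.

HB.instance Definition _ := isWDL.Build _ (X -> L) wcomplfK_le wcomplf_anti
  wcomplf_joinI dwcomplfK_ge dwcomplf_anti dwcomplf_meetU.
End FunWDL.

Section Filters.
Variables (d : Order.disp_t) (K : wdlType d).

Record is_lfilter (F : set K) : Prop := IsLFilter {
  lfilter_neq0 : F !=set0;
  lfilter_up : forall a b, F a -> a <= b -> F b;
  lfilter_meet : forall a b, F a -> F b -> F (a `&` b)
}.

Record lfilter := LFilter {
  lfilter_set :> set K;
  lfilterP : is_lfilter lfilter_set
}.

Lemma lfilter_inj : injective lfilter_set.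
Proof.
move=> [F hF] [G hG] /= FG; subst G; congr LFilter; exact: Prop_irrelevance.
Qed.

HB.instance Definition _ := gen_eqMixin lfilter.
HB.instance Definition _ := gen_choiceMixin lfilter.

Definition le_lfilter (F G : lfilter) : bool := `[< F `<=` G >].

Fact le_lfilter_refl : reflexive le_lfilter.
Proof. by move=> F; apply/asboolP. Qed.

Fact le_lfilter_anti : antisymmetric le_lfilter.
Proof.
move=> F G /andP[/asboolP FG /asboolP GF].
by apply/lfilter_inj/seteqP; split.
Qed.

Fact le_lfilter_trans : transitive le_lfilter.
Proof.
move=> G F H /asboolP FG /asboolP GH.
by apply/asboolP; exact: subset_trans GH.
Qed.

HB.instance Definition _ := Order.Le_isPOrder.Build set_display lfilter
  le_lfilter_refl le_lfilter_anti le_lfilter_trans.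

Lemma lfilter_top (F : lfilter) : (F : set K) \top.
Proof.
have [[a Fa] up _] := lfilterP F; apply: up Fa _; exact: lex1.
Qed.

Fact lfilterI_proof (F G : lfilter) : is_lfilter (F `&` G)%classic.
Proof.
split.
- by exists \top; split; exact: lfilter_top.
- move=> a b [Fa Ga] ab.
  by split; [exact: (lfilter_up (lfilterP F)) ab
            | exact: (lfilter_up (lfilterP G)) ab].
- move=> a b [Fa Ga] [Fb Gb].
  by split; [exact: (lfilter_meet (lfilterP F))
            | exact: (lfilter_meet (lfilterP G))].
Qed.

Fact lfilterU_proof (F G : lfilter) :
  is_lfilter (smallest is_lfilter (F `|` G)%classic).
Proof.
split.
- by exists \top => A [_]; apply; left; exact: lfilter_top.
- by move=> a b Fa ab A hA; exact: (lfilter_up hA.1) (Fa A hA) ab.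
- by move=> a b Fa Fb A hA; exact: (lfilter_meet hA.1) (Fa A hA) (Fb A hA).
Qed.

Definition lfilterI F G := LFilter (lfilterI_proof F G).
Definition lfilterU F G := LFilter (lfilterU_proof F G).

Fact le_lfilterI (H F G : lfilter) :
  (H <= lfilterI F G) = (H <= F) && (H <= G).
Proof.
apply/asboolP/andP => [HFG|[/asboolP HF /asboolP HG] a Ha].
  by split; apply/asboolP => a /HFG[].
by split; [exact: HF | exact: HG].
Qed.

Fact le_lfilterU (F G H : lfilter) :
  (lfilterU F G <= H) = (F <= H) && (G <= H).
Proof.
apply/asboolP/andP => [FGH|[/asboolP FH /asboolP GH]].
  by split; apply/asboolP => a Fa; apply: FGH => A [_]; apply; [left|right].
by apply: smallest_sub; [exact: lfilterP | move=> a [/FH|/GH]].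
Qed.

HB.instance Definition _ := Order.POrder_MeetJoin_isLattice.Build set_display
  lfilter le_lfilterI le_lfilterU.

Definition normal (F : set K) : Prop :=
  forall a, F a -> F (dwcompl (wcompl a)).

Definition NF : set (set K) := [set F | is_lfilter F /\ normal F].

Definition theta_of (H : set K) : set (K * K) :=
  [set ab | exists2 u, H u & ab.1 `|` wcompl u = ab.2 `|` wcompl u].

End Filters.

Section Congruences.
Variables (d : Order.disp_t) (K : wdlType d).

Record is_congruence (T : set (K * K)) : Prop := IsCongruence {
  congr_refl : forall a, T (a, a);
  congr_sym : forall a b, T (a, b) -> T (b, a);
  congr_trans : forall a b c, T (a, b) -> T (b, c) -> T (a, c);
  congr_meet : forall a b a' b',
    T (a, b) -> T (a', b') -> T (a `&` a', b `&` b');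
  congr_join : forall a b a' b',
    T (a, b) -> T (a', b') -> T (a `|` a', b `|` b');
  congr_wcompl : forall a b, T (a, b) -> T (wcompl a, wcompl b);
  congr_dwcompl : forall a b, T (a, b) -> T (dwcompl a, dwcompl b)
}.

Record congruence := Congruence {
  congruence_set :> set (K * K);
  congruenceP : is_congruence congruence_set
}.

Lemma congruence_inj : injective congruence_set.
Proof.
move=> [F hF] [G hG] /= FG; subst G; congr Congruence; exact: Prop_irrelevance.
Qed.

HB.instance Definition _ := gen_eqMixin congruence.
HB.instance Definition _ := gen_choiceMixin congruence.

Definition le_congruence (S T : congruence) : bool := `[< S `<=` T >].

Fact le_congruence_refl : reflexive le_congruence.
Proof. by move=> F; apply/asboolP. Qed.

Fact le_congruence_anti : antisymmetric le_congruence.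
Proof.
move=> F G /andP[/asboolP FG /asboolP GF].
by apply/congruence_inj/seteqP; split.
Qed.

Fact le_congruence_trans : transitive le_congruence.
Proof.
move=> G F H /asboolP FG /asboolP GH.
by apply/asboolP; exact: subset_trans GH.
Qed.

HB.instance Definition _ := Order.Le_isPOrder.Build set_display congruence
  le_congruence_refl le_congruence_anti le_congruence_trans.

Lemma bigcap_congruence (C : set (set (K * K))) :
  C `<=` is_congruence -> is_congruence (\bigcap_(T in C) T).
Proof.
move=> hC; split.
- by move=> a T /hC hT; apply: (congr_refl hT).
- by move=> a b ab T CT; apply: (congr_sym (hC _ CT)); exact: ab.
- move=> a b c ab bc T CT.
  by apply: (congr_trans (hC _ CT)); [exact: ab | exact: bc].
- move=> a b a' b' ab ab' T CT.
  by apply: (congr_meet (hC _ CT)); [exact: ab | exact: ab'].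
- move=> a b a' b' ab ab' T CT.
  by apply: (congr_join (hC _ CT)); [exact: ab | exact: ab'].
- by move=> a b ab T CT; apply: (congr_wcompl (hC _ CT)); exact: ab.
- by move=> a b ab T CT; apply: (congr_dwcompl (hC _ CT)); exact: ab.
Qed.

Lemma smallest_congruence (G : set (K * K)) :
  is_congruence (smallest is_congruence G).
Proof. by apply: bigcap_congruence => T []. Qed.

Fact congruenceI_proof (S T : congruence) : is_congruence (S `&` T)%classic.
Proof.
have -> : (S `&` T = \bigcap_(R in [set (S : set (K * K)); T : set _]) R)%classic.
  by rewrite bigcap_setU !bigcap_set1.
by apply: bigcap_congruence => _ [->|->]; exact: congruenceP.
Qed.

Definition congruenceI S T := Congruence (congruenceI_proof S T).
Definition congruenceU (S T : congruence) :=
  Congruence (smallest_congruence (S `|` T)%classic).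

Fact le_congruenceI (R S T : congruence) :
  (R <= congruenceI S T) = (R <= S) && (R <= T).
Proof.
apply/asboolP/andP => [RST|[/asboolP RS /asboolP RT] a Ra].
  by split; apply/asboolP => a /RST[].
by split; [exact: RS | exact: RT].
Qed.

Fact le_congruenceU (R S T : congruence) :
  (congruenceU R S <= T) = (R <= T) && (S <= T).
Proof.
apply/asboolP/andP => [RST|[/asboolP RT /asboolP ST]].
  by split; apply/asboolP => a Ra; apply: RST => A [_]; apply; [left|right].
by apply: smallest_sub; [exact: congruenceP | move=> a [/RT|/ST]].
Qed.

HB.instance Definition _ := Order.POrder_MeetJoin_isLattice.Build set_display
  congruence le_congruenceI le_congruenceU.

Definition Theta (F : set K) : congruence :=
  Congruence (smallest_congruence [set ab | F ab.1 /\ ab.2 = \top]).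

End Congruences.

Section AtPoint.
Variables (d : Order.disp_t) (L : wdlType d) (X : Type) (x : X).

Definition at_point (S : set L) : set (X -> L) := [set f | S (f x)].

Definition at_point2 (Y : set (L * L)) : set ((X -> L) * (X -> L)) :=
  [set fg | Y (fg.1 x, fg.2 x)].

Lemma at_point_lfilter (F : set L) : is_lfilter F -> is_lfilter (at_point F).
Proof.
move=> [[a Fa] up mt]; split.
- by exists (fun=> a).
- by move=> f g Ff /lefP fg; exact: up Ff (fg x).
- by move=> f g Ff Fg; exact: mt.
Qed.

Lemma at_point2_congruence (T : set (L * L)) :
  is_congruence T -> is_congruence (at_point2 T).
Proof.
move=> [rf sm tr mt jn wc dw]; split; rewrite /at_point2 /=.
- by move=> f; exact: rf.
- by move=> f g; exact: sm.
- by move=> f g h; exact: tr.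
- by move=> f g f' g'; exact: mt.
- by move=> f g f' g'; exact: jn.
- by move=> f g; exact: wc.
- by move=> f g; exact: dw.
Qed.

Definition gamma (F : lfilter L) : lfilter (X -> L) :=
  LFilter (at_point_lfilter (lfilterP F)).

Definition mu (T : congruence L) : congruence (X -> L) :=
  Congruence (at_point2_congruence (congruenceP T)).

End AtPoint.

(* Main.v *)
Require Import Defs.
From HB Require Import structures.
From mathcomp Require Import all_boot all_order.
From mathcomp Require Import boolp classical_sets.

Local Open Scope classical_set_scope.

(** Evaluation at [x] is a homomorphism from the power [X -> L] onto [L], and
    the constant maps are a homomorphic section of it.  Both [gamma x] and
    [mu x] are inverse images along evaluation, so surjectivity makes them
    injective, and inverse images commute with intersections, which are the
    meets of filters and of congruences.

    Joins are generated, so there the section is used: to show that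
    [gamma x (F `|` G)] lies below every filter [A] containing [gamma x F] and
    [gamma x G], pull [A] back along the constant maps.  This gives a filter of
    [L] above [F] and [G], hence above their join; and [A] recovers a map from
    the constant with the same value at [x], because it contains [indic \top],
    the map that is the top at [x] and the bottom elsewhere.  For congruences,
    two maps that agree at [x] are identified by [mu x S] for every [S], by
    reflexivity of [S], and the same argument applies.

    For the formula for [mu x (Theta F)] it suffices to prove two things.
    First, [theta_of] commutes with the passage to the power: a witness [u] in
    the filter [F] is extended by the bottom outside [x], where its weak
    complement is then the top and makes all maps equal
    ([theta_of_at_point]).  Second, [Theta F] is [theta_of F] in a distributive
    [L] ([Theta_theta_of]).  The nontrivial point of the latter is that
    [theta_of F] respects the two complementations.  For a witness [u], put
    [v := dwcompl (wcompl u)], which is in [F] by normality and disjoint from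
    [wcompl u].  Distributivity turns the identification of [a] and [b] by
    joining with [wcompl u] into one by meeting with [v], which [wcompl] turns
    into one by joining with [wcompl v] since it sends meets to joins; dually
    [dwcompl] sends joins to meets. *)

Import Order.TTheory.
Local Open Scope order_scope.

(** * Weak complements *)

Section WeakComplements.
Context {d : Order.disp_t} {K : wdlType d}.
Implicit Types x y : K.

Lemma joinx_wcompl x : x `|` wcompl x = \top.
Proof. by have := wcompl_joinI \top x; rewrite !meet1x. Qed.

Lemma meetx_dwcompl x : x `&` dwcompl x = \bot.
Proof. by have := dwcompl_meetU \bot x; rewrite !join0x. Qed.

Lemma wcompl0 : wcompl \bot = \top :> K.
Proof. by have := joinx_wcompl \bot; rewrite join0x. Qed.

Lemma wcompl1 : wcompl \top = \bot :> K.
Proof. by apply/eqP; rewrite -lex0 -wcompl0; exact: wcomplK_le. Qed.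

(** Being antitone with decreasing square, [wcompl] satisfies
    [wcompl x <= y] iff [wcompl y <= x]: from the dual order to the order it is
    left adjoint to itself, hence turns meets into joins. *)
Lemma wcomplI x y : wcompl (x `&` y) = wcompl x `|` wcompl y.
Proof.
apply/le_anti/andP; split; last first.
  by rewrite leUx; apply/andP; split;
    apply: wcompl_anti; [exact: leIl | exact: leIr].
apply: le_trans (wcomplK_le _); apply: wcompl_anti.
rewrite lexI; apply/andP; split.
  by apply: le_trans (wcomplK_le x); apply: wcompl_anti; exact: leUl.
by apply: le_trans (wcomplK_le y); apply: wcompl_anti; exact: leUr.
Qed.

Lemma dwcomplU x y : dwcompl (x `|` y) = dwcompl x `&` dwcompl y.
Proof.
apply/le_anti/andP; split.
  by rewrite lexI; apply/andP; split;
    apply: dwcompl_anti; [exact: leUl | exact: leUr].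
apply: le_trans (dwcomplK_ge _) _; apply: dwcompl_anti.
rewrite leUx; apply/andP; split.
  by apply: le_trans (dwcomplK_ge x) _; apply: dwcompl_anti; exact: leIl.
by apply: le_trans (dwcomplK_ge y) _; apply: dwcompl_anti; exact: leIr.
Qed.

End WeakComplements.

(** * Congruences generated by normal filters in the distributive case *)

Lemma join_distributive {d : Order.disp_t} {L : latticeType d} :
  left_distributive (@Order.meet d L) (@Order.join d L) ->
  left_distributive (@Order.join d L) (@Order.meet d L).
Proof.
move=> mUl a b c.
by rewrite [RHS]mUl [c `&` _]meetC joinIK [a `&` (_ `|` _)]meetC mUl -joinA
  [c `&` a]meetC meetUK [b `&` a]meetC.
Qed.

Section ThetaOf.
Context {d : Order.disp_t} {L : wdlType d}.
Variable F : set L.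
Hypothesis distr : left_distributive (@Order.meet d L) (@Order.join d L).
Hypothesis filtF : is_lfilter F.
Hypothesis normF : normal F.

(** Identification by a join passes to every element of the filter below the
    witness, so that two pairs can be given a common witness. *)
Lemma theta_of_le (u v a b : L) : v <= u ->
  a `|` wcompl u = b `|` wcompl u -> a `|` wcompl v = b `|` wcompl v.
Proof.
move=> /wcompl_anti/join_idPr <- eab.
by rewrite !joinA eab.
Qed.

Lemma theta_of_common {a b a' b' : L} :
  theta_of F (a, b) -> theta_of F (a', b') ->
  exists2 u, F u &
    a `|` wcompl u = b `|` wcompl u /\ a' `|` wcompl u = b' `|` wcompl u.
Proof.
move=> [u /= Fu eu] [v /= Fv ev].
exists (u `&` v); first exact: lfilter_meet.
by split; [apply: theta_of_le eu; exact: leIl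
          | apply: theta_of_le ev; exact: leIr].
Qed.

(** Normality provides an element [v] of the filter disjoint from [wcompl u];
    meeting with it cancels [wcompl u]. *)
Lemma theta_of_meet (a b : L) : theta_of F (a, b) ->
  exists2 v, F v & a `&` v = b `&` v.
Proof.
move=> [u /= Fu eu]; exists (dwcompl (wcompl u)); first exact: normF.
have meet_v c : c `&` dwcompl (wcompl u) =
    (c `|` wcompl u) `&` dwcompl (wcompl u).
  by rewrite distr meetx_dwcompl joinx0.
by rewrite meet_v eu -meet_v.
Qed.

Lemma theta_of_wcompl (a b : L) :
  theta_of F (a, b) -> theta_of F (wcompl a, wcompl b).
Proof.
by move=> /theta_of_meet[v Fv ev]; exists v => //=; rewrite -!wcomplI ev.
Qed.

(** The De Morgan law for [dwcompl] first yields equality after a meet with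
    [v]; joining with [wcompl v] removes that meet, as [v] joins with its weak
    complement to the top. *)
Lemma theta_of_dwcompl (a b : L) :
  theta_of F (a, b) -> theta_of F (dwcompl a, dwcompl b).
Proof.
move=> [u /= Fu eu]; set v := dwcompl (wcompl u).
exists v => /=; first exact: normF.
have join_v c : dwcompl c `|` wcompl v = dwcompl (c `|` wcompl u) `|` wcompl v.
  by rewrite dwcomplU (join_distributive distr) joinx_wcompl meetx1.
by rewrite join_v eu -join_v.
Qed.

Lemma theta_of_congruence : is_congruence (theta_of F).
Proof.
split.
- by move=> a; have [u Fu] := lfilter_neq0 filtF; exists u.
- by move=> a b [u Fu eu]; exists u.
- move=> a b c ab /(theta_of_common ab)[u Fu [eab ebc]].
  by exists u => //=; rewrite eab.
- move=> a b a' b' ab /(theta_of_common ab)[u Fu [e e']].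
  by exists u => //=; rewrite !(join_distributive distr) e e'.
- move=> a b a' b' ab /(theta_of_common ab)[u Fu [e e']].
  by exists u => //=; rewrite -!joinA e' !joinA [a `|` b']joinC
    [b `|` b']joinC -!joinA e.
- exact: theta_of_wcompl.
- exact: theta_of_dwcompl.
Qed.

Lemma Theta_theta_of : Theta F = theta_of F :> set (L * L).
Proof.
apply/seteqP; split.
  apply: smallest_sub; first exact: theta_of_congruence.
  move=> [a b] /= [Fa ->]; exists a => //=.
  by rewrite joinx_wcompl join1x.
move=> [a b] [u /= Fu eu] T [cT FT].
(* The congruence sends [u] to the top, hence [wcompl u] to the bottom. *)
have Tu0 : T (wcompl u, \bot).
  by rewrite -wcompl1; apply: (congr_wcompl cT); exact: FT.
have join_u c : T (c `|` wcompl u, c).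
  rewrite -[X in T (_, X)]joinx0.
  exact: (congr_join cT (congr_refl cT c) Tu0).
apply: (congr_trans cT _ (join_u b)).
by rewrite -eu; apply: (congr_sym cT); exact: join_u.
Qed.

End ThetaOf.

(** * Filters and congruences of the power at a point *)

Section AtPointTheory.
Context {d : Order.disp_t} {L : wdlType d} {X : Type}.
Variable x : X.

Definition indic (u : L) : X -> L := fun y => if `[< y = x >] then u else \bot.

Lemma indicE u : indic u x = u.
Proof. by rewrite /indic asboolT. Qed.

Lemma at_point_inj : injective (@at_point d L X x).
Proof.
move=> S S' eS; apply/funext => a.
exact: (congr1 (fun A : set (X -> L) => A (fun=> a)) eS).
Qed.

Lemma at_point2_inj : injective (@at_point2 d L X x).
Proof.
move=> Y Y' eY; apply/funext => -[a b].
exact: (congr1 (fun A : set ((X -> L) * (X -> L)) => A (fun=> a, fun=> b)) eY).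
Qed.

Lemma gamma_inj : injective (gamma x : lfilter L -> lfilter (X -> L)).
Proof. by move=> F G /(congr1 (@lfilter_set _ _))/at_point_inj/lfilter_inj. Qed.

Lemma mu_inj : injective (mu x : congruence L -> congruence (X -> L)).
Proof.
by move=> S T /(congr1 (@congruence_set _ _))/at_point2_inj/congruence_inj.
Qed.

Lemma gamma_meet :
  Order.meet_morphism (gamma x : lfilter L -> lfilter (X -> L)).
Proof. by move=> F G; exact: lfilter_inj. Qed.

Lemma mu_meet :
  Order.meet_morphism (mu x : congruence L -> congruence (X -> L)).
Proof. by move=> S T; exact: congruence_inj. Qed.

Lemma gamma_homo (F G : lfilter L) : F <= G -> gamma x F <= gamma x G.
Proof. by move=> /asboolP FG; apply/asboolP => f; exact: FG. Qed.

Lemma mu_homo (S T : congruence L) : S <= T -> mu x S <= mu x T.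
Proof. by move=> /asboolP ST; apply/asboolP => f; exact: ST. Qed.

Lemma const_filter (A : set (X -> L)) :
  is_lfilter A -> is_lfilter [set a | A (fun=> a)].
Proof.
move=> filtA; split.
- by exists \top; exact: (lfilter_top (LFilter filtA)).
- move=> a b Aa ab; apply: (lfilter_up filtA Aa).
  by apply/lefP.
- by move=> a b Aa Ab; exact: (lfilter_meet filtA Aa Ab).
Qed.

Lemma const_congruence (A : set ((X -> L) * (X -> L))) :
  is_congruence A -> is_congruence [set ab | A (fun=> ab.1, fun=> ab.2)].
Proof.
move=> congA; split => /=.
- by move=> a; exact: (congr_refl congA).
- by move=> a b; exact: (congr_sym congA).
- by move=> a b c; exact: (congr_trans congA).
- by move=> a b a' b'; exact: (congr_meet congA).
- by move=> a b a' b'; exact: (congr_join congA).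
- by move=> a b; exact: (congr_wcompl congA).
- by move=> a b; exact: (congr_dwcompl congA).
Qed.

Lemma gamma_join :
  Order.join_morphism (gamma x : lfilter L -> lfilter (X -> L)).
Proof.
move=> F G; apply/le_anti/andP; split; last first.
  by rewrite leUx !gamma_homo ?leUl ?leUr.
apply/asboolP => f FGf.
(* The join is by definition an intersection of filters, and [A] is one of
   them. *)
change ((lfilterU (gamma x F) (gamma x G) : set (X -> L)) f) => A [filtA FGA].
have Afx : A (fun=> f x).
  apply: (FGf [set a | A (fun=> a)]); split; first exact: const_filter.
  by move=> a [Fa|Ga]; apply: FGA; [left|right].
have A1 : A (indic \top).
  by apply: FGA; left; rewrite /= /at_point /= indicE; exact: lfilter_top.
apply: (lfilter_up filtA (lfilter_meet filtA Afx A1)).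
apply/lefP => y; rewrite meetfE /indic.
by case: asboolP => [->|_]; rewrite ?meetx0 ?le0x ?meetx1.
Qed.

Lemma mu_join :
  Order.join_morphism (mu x : congruence L -> congruence (X -> L)).
Proof.
move=> S T; apply/le_anti/andP; split; last first.
  by rewrite leUx !mu_homo ?leUl ?leUr.
apply/asboolP => -[f g] STfg.
change ((congruenceU (mu x S) (mu x T) : set _) (f, g)) => A [congA STA].
have Afgx : A (fun=> f x, fun=> g x).
  apply: (STfg [set ab | A (fun=> ab.1, fun=> ab.2)]).
  split; first exact: const_congruence.
  by move=> [a b] [Sab|Tab]; apply: STA; [left|right].
have A_agree (h k : X -> L) : h x = k x -> A (h, k).
  move=> hk; apply: STA; left; rewrite /= /at_point2 /= hk.
  exact: congr_refl (congruenceP S) _.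
apply: (congr_trans congA (b := fun=> f x)); first exact: A_agree.
by apply: (congr_trans congA Afgx); exact: A_agree.
Qed.

Lemma at_point_normal (F : set L) : normal F -> normal (at_point x F).
Proof. by move=> normF f; exact: normF. Qed.

(** The operations being pointwise, a witness matters only through
    its value at [x]; elsewhere the bottom can be taken, whose weak complement
    identifies everything. *)
Lemma theta_of_at_point (F : set L) :
  theta_of (at_point x F) = at_point2 x (theta_of F).
Proof.
apply/seteqP; split=> -[f g] [u /= Fu eu].
  by exists (u x) => //; exact: (congr1 (fun h => h x) eu).
exists (indic u); first by rewrite /at_point /= indicE.
have wcomplE y : wcompl (indic u) y = wcompl (indic u y) by [].
apply/funext => y; rewrite !joinfE wcomplE /indic.
by case: asboolP => [->|_] //; rewrite wcompl0 !joinx1.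
Qed.

End AtPointTheory.

Theorem proposition29 (d : Order.disp_t) (L : wdlType d) (X : Type) (x : X) :
  (* (1) *)
  (injective (gamma x : lfilter L -> lfilter (X -> L)) /\
   Order.meet_morphism (gamma x : lfilter L -> lfilter (X -> L)) /\
   Order.join_morphism (gamma x : lfilter L -> lfilter (X -> L)) /\
   (forall F : lfilter L, normal F -> normal (gamma x F))) /\
  (* (2) *)
  (injective (mu x : congruence L -> congruence (X -> L)) /\
   Order.meet_morphism (mu x : congruence L -> congruence (X -> L)) /\
   Order.join_morphism (mu x : congruence L -> congruence (X -> L)) /\
   (left_distributive (@Order.meet d L) (@Order.join d L) ->
    forall F : set L, NF F -> mu x (Theta F) = theta_of (at_point x F) :> set _)) /\
  (* (3) *)
  [set at_point x F | F in @NF d L] `<=` @NF _ (X -> L).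
Proof.
split; [|split].
- split; [exact: gamma_inj | split; [exact: gamma_meet | split]].
    exact: gamma_join.
  by move=> F; exact: at_point_normal.
- split; [exact: mu_inj | split; [exact: mu_meet | split]].
    exact: mu_join.
  move=> distr F [filtF normF].
  by rewrite theta_of_at_point -Theta_theta_of.
- move=> _ [F [filtF normF] <-].
  by split; [exact: at_point_lfilter | exact: at_point_normal].
Qed.
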